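(* Let $1\le k\le n$ and let $A=[a_1,i_1]\cup\cdots\cup[a_m,i_m]$ be a subset of $[n]$, where $[a_1,i_1],\dots,[a_m,i_m]$ are the (disjoint) cyclic components of $A$, of lengths $l_1,\dots,l_m$ respectively. Let $\sigma=\overleftarrow{\rho_A}(\pi_{k,n})$. Then the set of circuits of the positroid $P_\sigma$ represented by $\sigma$ is $$\mathcal C_A=\bigl\{[i_j+1,\,i_j+k-l_j] : j=1,\dots,m\bigr\}\cup\Bigl\{C\subseteq[n] : |C|=k,\ [i_j+1,\,i_j+k-l_j]\not\subseteq C\text{ for all } j=1,\dots,m\Bigr\},$$ where elements are read modulo $n$ in $[n]$. Moreover, the circuits of $P_\sigma$ of size less than $k$ can be read from the decorated permutation $\sigma$: they are precisely the cyclic intervals $[i_j+1,\,\sigma^{-1}(i_j+1)]$, $j=1,\dots,m$.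
   Context: Notation: $[n]=\{1,\dots,n\}$. For $a,b\in[n]$, the cyclic interval $[a,b]$ is $\{a,a+1,\dots,b\}$ if $a\le b$ and $\{a,a+1,\dots,n,1,\dots,b\}$ if $b<a$; its length is its number of elements. The cyclic components of $A\subseteq[n]$ are the maximal cyclic intervals contained in $A$ (e.g. for $n=13$, $A=\{1,2,5,8,9,12,13\}$ has components $[12,2],\{5\},[8,9]$); $m=0$ if $A=\emptyset$. Decorated permutations: a decorated permutation of $[n]$ is a bijection $\sigma:[n]\to[n]$ together with a decoration of each fixed point $i$ as either $\sigma(i)=\underline{i}$ or $\sigma(i)=\overline{i}$. For $i\in[n]$ let $<_i$ be the total order $i<_i i+1<_i\cdots<_i n<_i 1<_i\cdots<_i i-1$. An element $j\in[n]$ is a weak $i$-excedance of $\sigma$ if $\sigma(j)=\overline{j}$ or $j<_i\sigma(j)$; $W_i(\sigma)$ is the set of weak $i$-excedances. The number $|W_i(\sigma)|$ does not depend on $i$ and is the number of weak excedances of $\sigma$. Positroids: for $r$-subsets $S=\{s_1<_i\cdots<_i s_r\}$ and $T=\{t_1<_i\cdots<_i t_r\}$ write $S\le_i T$ if $s_j\le_i t_j$ for all $j$. For a decorated permutation $\sigma$ with $r$ weak excedances, the positroid $P_\sigma$ is the rank-$r$ matroid on $[n]$ whose bases are the $r$-subsets $B$ of $[n]$ with $B\ge_i W_i(\sigma)$ for all $i\in[n]$. A circuit is a minimal dependent set. Uniform permutation: $\pi_{k,n}$ is the decorated permutation with $k$ weak excedances given by $\pi_{k,n}(i)\equiv n-k+i\pmod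 n$, i.e. in one-line notation $(n-k+1)\cdots n\,1\,2\cdots(n-k)$ (for $k=n$ all fixed points are overlined). Its positroid is the uniform matroid $U_{k,n}$, whose bases are all $k$-subsets of $[n]$. Cyclic shift: for a decorated permutation $\pi$ of $[n]$ (in one-line notation) and $A\subseteq[n]$, $\overleftarrow{\rho_A}(\pi)$ is obtained by the following moves in order: (F) freeze the value $i$ in $\pi$ if and only if $i\in A$; (S) cyclically shift the remaining (unfrozen) values one place to the left, jumping over frozen values (so each unfrozen position receives the value of the next unfrozen position to its right, cyclically); (D) decorate any fixed point $i$ appearing after the shift (at an unfrozen position) as $\underline{i}$; frozen fixed points keep their decoration. Example: for $\pi=34512$, $\overleftarrow{\rho_{\{2,5\}}}(\pi)=41532$ and $\overleftarrow{\rho_{\{1,2\}}}(\pi)=45\underline{3}12$.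
   Formalization: The formal theorem additionally assumes that every component length satisfies l_j < k, and that m ≤ 1 when k = n; the claim is false whenever either assumption fails (e.g. n=3, k=1, A={1}; n=k=4, A={1,3}). *)

(* Defs.v *)
From HB Require Import structures.
From mathcomp Require Import all_boot all_fingroup.

Set Implicit Arguments.
Unset Strict Implicit.
Unset Printing Implicit Defensive.

(* The ground set [n] = {1, ..., n} is 'I_n; the label i is  *)
(* represented by the ordinal i - 1.  All the notions below are expressed     *)
(* with addition modulo n, so this relabelling is harmless.                   *)

Fact cadd_subproof n (i : 'I_n) (t : nat) : (i + t) %% n < n.
Proof. by rewrite ltn_mod (leq_ltn_trans (leq0n i) (ltn_ord i)). Qed.

(* i + t read modulo n in the ground set *)
Definition cadd n (i : 'I_n) (t : nat) : 'I_n := Ordinal (cadd_subproof i t).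

Definition cint n (a b : 'I_n) : {set 'I_n} :=
  [set x : 'I_n | if a <= b then a <= x <= b else (a <= x) || (x <= b)].

Definition cyclic_interval n (S : {set 'I_n}) : bool :=
  [exists a : 'I_n, exists b : 'I_n, S == cint a b].

Definition cyclic_components n (A : {set 'I_n}) : {set {set 'I_n}} :=
  [set S | maxset (fun T : {set 'I_n} => cyclic_interval T && (T \subset A)) S].

(* The position of x in the list i, i+1, ..., n, 1, ..., i-1.                 *)
Definition cpos n (i x : 'I_n) : nat := (x + (n - i)) %% n.
Definition cle n (i : 'I_n) : rel 'I_n := fun x y => cpos i x <= cpos i y.
Definition clt n (i : 'I_n) : rel 'I_n := fun x y => cpos i x < cpos i y.

(* dp_over is the set of overlined fixed points; the other fixed points are   *)
(* underlined.                                                                *)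
Record decperm (n : nat) := DecPerm {
  dp_perm :> {perm 'I_n};
  dp_over : {set 'I_n};
  dp_over_fixed : dp_over \subset [set i | dp_perm i == i]
}.

Definition weak_exc n (sigma : decperm n) (i : 'I_n) : {set 'I_n} :=
  [set j | (j \in dp_over sigma) || clt i j (sigma j)].

Definition csort n (i : 'I_n) (S : {set 'I_n}) : seq 'I_n :=
  sort (@cle n i) (enum S).

(* S <=_i T; all2 also requires S and T to have the same cardinality.         *)
Definition gale n (i : 'I_n) (S T : {set 'I_n}) : bool :=
  all2 (@cle n i) (csort i S) (csort i T).

(* The set of bases of the positroid of sigma. The rank is the number of weak *)
(* excedances, i.e. the common cardinality of all the weak_exc sigma i.       *)
Definition positroid n (sigma : decperm n) : {set {set 'I_n}} :=
  [set B : {set 'I_n} | [forall i : 'I_n,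
     (#|B| == #|weak_exc sigma i|) && gale i (weak_exc sigma i) B]].

(* Matroids are given by their sets of bases. *)
Definition independent (T : finType) (bases : {set {set T}}) (S : {set T}) :=
  [exists B in bases, S \subset B].

Definition circuits (T : finType) (bases : {set {set T}}) : {set {set T}} :=
  [set C | minset (fun S : {set T} => ~~ independent bases S) C].

Lemma uniform_inj n k : injective (fun i : 'I_n => cadd i (n - k)).
Proof.
move=> i j /(congr1 val) /= /eqP.
by rewrite eqn_modDr !modn_small ?ltn_ord // => /eqP /val_inj.
Qed.

Definition uniform_perm n k : {perm 'I_n} := perm (@uniform_inj n k).

Fact uniform_over_fixed n k :
  (if k == n then [set: 'I_n] else set0)
    \subset [set i | uniform_perm n k i == i].
Proof.
case: eqP => [->|_]; last exact: sub0set.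
apply/subsetP => i _; rewrite inE permE; apply/eqP/val_inj => /=.
by rewrite subnn addn0 modn_small.
Qed.

Definition uniform_decperm n k : decperm n :=
  DecPerm (uniform_over_fixed n k).

Definition unfrozen n (A : {set 'I_n}) (pi : {perm 'I_n}) : seq 'I_n :=
  enum [set p | pi p \notin A].

(* next s p is the element following p in s, cyclically, if p is in s, and p  *)
(* otherwise.                                                                 *)
Definition next_unfrozen n (A : {set 'I_n}) (pi : {perm 'I_n}) : {perm 'I_n} :=
  perm (can_inj (prev_next (enum_uniq [set p | pi p \notin A]))).

Lemma next_unfrozenE n (A : {set 'I_n}) (pi : {perm 'I_n}) (p : 'I_n) :
  next_unfrozen A pi p = next (unfrozen A pi) p.
Proof. by rewrite permE. Qed.

(* Permutations compose left to right: position p receives the value          *)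
(* pi (next (unfrozen A pi) p).                                               *)
Definition shift_perm n (A : {set 'I_n}) (pi : {perm 'I_n}) : {perm 'I_n} :=
  (next_unfrozen A pi * pi)%g.

Lemma shift_permE n (A : {set 'I_n}) (pi : {perm 'I_n}) (p : 'I_n) :
  shift_perm A pi p = pi (next (unfrozen A pi) p).
Proof. by rewrite permM next_unfrozenE. Qed.

Fact shift_over_fixed n (A : {set 'I_n}) (pi : decperm n) :
  dp_over pi :&: A \subset [set i | shift_perm A pi i == i].
Proof.
apply/subsetP => i /setIP[iO iA]; rewrite inE shift_permE.
have /[!inE] /eqP pii := subsetP (dp_over_fixed pi) _ iO.
have iU : i \notin unfrozen A pi by rewrite mem_enum inE pii iA.
by rewrite next_nth (negPf iU) pii.
Qed.

(* A fixed point i of the result which was frozen is a fixed point of pi in   *)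
(* A, and keeps its decoration; all the others are underlined.                *)
Definition cyclic_shift n (A : {set 'I_n}) (pi : decperm n) : decperm n :=
  DecPerm (shift_over_fixed A pi).

(* Main.v *)
Require Import Defs.
From mathcomp Require Import all_boot all_fingroup.
From mathcomp Require Import zify.

(* Let g(i) be the least g >= 1 with i - g not in A, so that g(i) <= k. Then
   W_i is {i, ..., i + k - 1} with i + k - g(i) removed, and a (k-1)-set B
   satisfies W_i <=_i B iff B does not contain T_i = [i, i + k - g(i)]. If i is
   in A and u is the next element outside A, then T_u is contained in T_i; hence
   the bases are the (k-1)-sets containing no T_i with i outside A. For such i,
   T_i is a k-set when g(i) = 1, and otherwise i = i_j + 1, g(i) = l_j + 1 and
   T_i = [i_j + 1, i_j + k - l_j].

   A set C with fewer than k - 1 elements that contains no T_i can be enlarged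
   keeping this property: otherwise every x outside C is the only element
   outside C of some T_i, and for x, y cyclically consecutive outside C, with
   x in T_i, the elements i, ..., i + k all lie in C, x or y, which is impossible
   when k < n since there are k + 1 of them (when k = n, there is at most one T_i
   of size less than k, while a T_i of size n contains both x and y). So a
   set is independent iff it has fewer than k elements and contains no T_i, and since
   the T_i of size less than k form an antichain they are circuits. *)

Set Implicit Arguments.
Unset Strict Implicit.
Unset Printing Implicit Defensive.

(** * Arithmetic modulo n, cyclic intervals, and successors in enumerations *)

Section Cyclic.
Variable n : nat.
Implicit Types (i x p u : 'I_n) (A U : {set 'I_n}).

Lemma caddD i s t : cadd (cadd i s) t = cadd i (s + t).
Proof. by apply/val_inj; rewrite /= modnDml addnA. Qed.

Lemma cadd_size i : cadd i n = i.
Proof. by apply/val_inj; rewrite /= modnDr modn_small. Qed.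

Lemma cadd0 i : cadd i 0 = i.
Proof. by apply/val_inj; rewrite /= addn0 modn_small. Qed.

Lemma cadd_mod i s : cadd i (s %% n) = cadd i s.
Proof. by apply/val_inj; rewrite /= modnDmr. Qed.

Lemma cadd_inj s : injective (fun i => cadd i s).
Proof.
move=> i j /(congr1 val) /= /eqP.
by rewrite eqn_modDr !modn_small ?ltn_ord // => /eqP /val_inj.
Qed.

Lemma cadd_cancel i j s t : t <= s -> cadd i s = cadd j t -> j = cadd i (s - t).
Proof.
move=> le_ts e; apply: (@cadd_inj t) => /=.
by rewrite -e caddD subnK.
Qed.

Lemma cpos_lt i x : cpos i x < n.
Proof. by rewrite ltn_mod (leq_ltn_trans (leq0n i) (ltn_ord i)). Qed.

Lemma cposK i x : cadd i (cpos i x) = x.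
Proof.
rewrite cadd_mod; apply/val_inj => /=.
have -> : i + (x + (n - i)) = x + n by have := ltn_ord i; lia.
by rewrite modnDr modn_small.
Qed.

Lemma cpos_cadd i s : cpos i (cadd i s) = s %% n.
Proof.
rewrite /cpos /= modnDml.
have -> : i + s + (n - i) = s + n by have := ltn_ord i; lia.
by rewrite modnDr.
Qed.

Lemma cpos_cadd_small i s : s < n -> cpos i (cadd i s) = s.
Proof. by move=> lt_sn; rewrite cpos_cadd modn_small. Qed.

Lemma cpos_inj i : injective (cpos i).
Proof. by move=> x y eq_xy; rewrite -(cposK i x) eq_xy cposK. Qed.

Lemma cpos_ii i : cpos i i = 0.
Proof. by rewrite -{2}(cadd0 i) cpos_cadd mod0n. Qed.

Lemma cintE i x : cint i x = [set y | cpos i y <= cpos i x].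
Proof.
apply/setP => y; rewrite !inE.
have cE (z : 'I_n) : cpos i z = if i <= z then z - i else z + n - i.
  have [zn i_n] := (ltn_ord z, ltn_ord i).
  rewrite /cpos; case: leqP => [le_iz|lt_zi]; last by rewrite modn_small; lia.
  by have -> : z + (n - i) = z - i + n; [lia | rewrite modnDr modn_small; lia].
have [[yn xn] i_n] := (ltn_ord y, ltn_ord x, ltn_ord i).
by rewrite !cE; case: (leqP i x); case: (leqP i y); lia.
Qed.

Lemma card_arc i t : #|[set x | cpos i x < t]| = minn t n.
Proof.
have inj : injective (cadd i \o @nat_of_ord (minn t n)).
  have lt_n (r : 'I_(minn t n)) : r < n by have := ltn_ord r; lia.
  by move=> r s /(congr1 (cpos i)) /=; rewrite !cpos_cadd_small // => /val_inj.
rewrite -[RHS]card_ord -(card_codom inj); apply: eq_card => x.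
apply/idP/codomP => [lt_xt | [r ->]] /=; last first.
  have := ltn_ord r; rewrite leq_min => /andP[rt rn].
  by rewrite inE cpos_cadd_small.
rewrite inE in lt_xt; have lt : cpos i x < minn t n by rewrite leq_min lt_xt cpos_lt.
by exists (Ordinal lt); rewrite /= cposK.
Qed.

Lemma map_cadd_iota i : [seq cadd i s | s <- iota 0 n] = rot i (enum 'I_n).
Proof.
apply: (@eq_from_nth _ i) => [|s]; rewrite size_map size_iota.
  by rewrite size_rot size_enum_ord.
move=> lt_sn; apply/val_inj.
rewrite (nth_map 0) ?size_iota // nth_iota //= /rot nth_cat size_drop size_enum_ord.
have lt_i := ltn_ord i.
case: ltnP => h.
  by rewrite nth_drop nth_enum_ord ?modn_small; lia.
rewrite nth_take ?nth_enum_ord; try lia.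
have -> : i + (0 + s) = s - (n - i) + n by lia.
by rewrite modnDr modn_small; lia.
Qed.

Lemma filter_rot (T : Type) (a : pred T) (s : seq T) m :
  exists m', filter a (rot m s) = rot m' (filter a s).
Proof.
exists (size (filter a (take m s))).
by rewrite -{3}(cat_take_drop m s) filter_cat rot_size_cat /rot filter_cat.
Qed.

(** [next] in a duplicate-free list is invariant under rotation, so the enumeration may be taken to
    start at [p]; the [d - 1] candidates that follow are filtered out. *)
Lemma next_enum U p d :
  p \in U -> 0 < d <= n -> cadd p d \in U ->
  (forall s, 0 < s < d -> cadd p s \notin U) ->
  next (enum U) p = cadd p d.
Proof.
move=> pU /andP[d_gt0 le_dn] dU minU.
have eU : enum U = filter (mem U) (enum 'I_n) by rewrite {1}/enum_mem enumT.
have [m' em] := filter_rot (mem U) (enum 'I_n) p.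
rewrite -(next_rot m' (enum_uniq U)) eU -em -map_cadd_iota.
have -> : iota 0 n = 0 :: iota 1 d.-1 ++ iota d (n - d).
  have -> : iota 0 n = iota 0 (1 + (d.-1 + (n - d))) by congr iota; lia.
  by rewrite !iotaD /=; congr (_ :: _ ++ iota _ _); lia.
rewrite /= cadd0 pU map_cat filter_cat.
rewrite [filter _ (map _ (iota _ d.-1))](_ : _ = [::]); last first.
  apply/eqP; rewrite -(negbK (_ == _)) -has_filter; apply/hasPn => x.
  by case/mapP => s; rewrite mem_iota => hs ->; apply: minU; lia.
rewrite cat0s.
(* If [d = n], only [p] is left and it is its own successor. *)
move: le_dn; rewrite leq_eqVlt => /orP[/eqP dn | lt_dn].
  have -> : n - d = 0 by lia.
  by rewrite /= eqxx dn cadd_size.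
have -> : n - d = (n - d).-1.+1 by lia.
by rewrite /= dU /= eqxx.
Qed.

End Cyclic.

(** * The Gale order against an interval with one element removed *)

Lemma all2_leq_iota m t :
  sorted ltn t -> all (leq m) t -> all2 leq (iota m (size t)) t.
Proof.
elim: t m => //= x t IH m path_t /andP[le_mx _].
rewrite le_mx IH ?(path_sorted path_t) //.
apply: sub_all (order_path_min ltn_trans path_t) => y /=; lia.
Qed.

(** If [t] contains [m, ..., m + c], these are its first entries, and entry [c] falls short of
    [m + c + 1]. If one of them is missing, every entry from index [c] on is pushed up by at least
    one. *)
Lemma all2_leq_skip m c t :
  sorted ltn t -> all (leq m) t -> c <= size t ->
  all2 leq (iota m c ++ iota (m + c).+1 (size t - c)) t
    = ~~ all (mem t) (iota m c.+1).
Proof.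
elim: t m c => [|x t IH] m c; first by case: c.
rewrite [sorted _ _]/= [all _ _]/= => path_t /andP[le_mx _] le_c.
have lt_xt := order_path_min ltn_trans path_t.
have t_sorted := path_sorted path_t.
have notin_t y : y <= x -> y \notin t.
  by move=> le_yx; apply/negP => /(allP lt_xt) /=; lia.
case: c le_c => [_|c le_c].
  rewrite /= addn0 andbT inE negb_or (notin_t m) // andbT.
  rewrite ltn_neqAle le_mx andbT.
  case: (eqVneq m x) => //= neq_mx.
  apply: all2_leq_iota => //; apply: sub_all lt_xt => y /=; lia.
have all_t : all (leq m.+1) t by apply: sub_all lt_xt => y /=; lia.
have -> : iota m c.+2 = m :: iota m.+1 c.+1 by [].
have -> : iota m c.+1 = m :: iota m.+1 c by [].
rewrite cat_cons [all2 _ _ _]/= le_mx [size _]/= subSS addnS -addSn IH //.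
have -> : all (mem (x :: t)) (m :: iota m.+1 c.+1) =
    (m \in x :: t) && all (mem (x :: t)) (iota m.+1 c.+1) by [].
move: le_mx; rewrite leq_eqVlt => /orP[/eqP <- | lt_mx].
  rewrite mem_head; congr (~~ _); apply: eq_in_all => y.
  rewrite mem_iota => /andP[lt_my _].
  by rewrite /= in_cons gtn_eqF.
by rewrite inE negb_and negb_or ltn_eqF //= (negPf (notin_t _ lt_mx)) notin_t // ltnW.
Qed.

Section Gale.
Variable n : nat.
Implicit Types (i x : 'I_n) (B W : {set 'I_n}).

Lemma csortE i B :
  csort i B = [seq cadd i s | s <- iota 0 n & cadd i s \in B].
Proof.
have cle_tr : transitive (@cle n i) by move=> y x z; apply: leq_trans.
apply: (@sorted_eq _ (@cle n i)) => //.
- by move=> x y; rewrite -eqn_leq => /eqP/cpos_inj.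
- by apply: sort_sorted => x y; apply: leq_total.
- rewrite sorted_map.
  have: sorted leq [seq s <- iota 0 n | cadd i s \in B].
    by apply: sorted_filter; [apply: leq_trans | apply: iota_sorted].
  apply: (@sub_in_sorted _ (fun s => s < n)) => [s t ? ? le_st|].
    by rewrite /= /cle !cpos_cadd_small.
  by apply/allP => s; rewrite mem_filter mem_iota => /andP[_].
- rewrite perm_sort; apply: uniq_perm; first exact: enum_uniq.
    rewrite map_inj_in_uniq; first by rewrite filter_uniq ?iota_uniq.
    move=> s t; rewrite !mem_filter !mem_iota => /andP[_ /= ltsn] /andP[_ /= lttn].
    by move=> /(congr1 (cpos i)); rewrite !cpos_cadd_small.
  move=> x; rewrite mem_enum; apply/idP/mapP => [xB | [s]]; last first.
    by rewrite mem_filter => /andP[sB _] ->.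
  by exists (cpos i x); rewrite ?cposK // mem_filter cposK xB mem_iota cpos_lt.
Qed.

Lemma size_csort i B : size (csort i B) = #|B|.
Proof. by rewrite size_sort -cardE. Qed.

Lemma gale_offsets i W B : gale i W B =
  all2 leq [seq s <- iota 0 n | cadd i s \in W]
           [seq s <- iota 0 n | cadd i s \in B].
Proof.
rewrite /gale !csortE.
set s := filter _ _; set t := filter _ _.
have: all (gtn n) s by apply/allP => x; rewrite mem_filter mem_iota => /andP[_].
have: all (gtn n) t by apply/allP => x; rewrite mem_filter mem_iota => /andP[_].
elim: s t => [|x s IH] [|y t] //= /andP[yn tn] /andP[xn sn].
by rewrite IH // /cle !cpos_cadd_small.
Qed.

Variables (k g : nat) (i : 'I_n) (W : {set 'I_n}).
Hypotheses (g_gt0 : 0 < g) (le_gk : g <= k) (le_kn : k <= n).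
(** The shape that [weak_exc_shift] gives to W_i, with [g] the gap at [i]. *)
Hypothesis W_def : W = [set x | (cpos i x < k) && (cpos i x + g != k)].

Lemma offsets_skip :
  [seq s <- iota 0 n | cadd i s \in W]
    = iota 0 (k - g) ++ iota (k - g).+1 (g - 1).
Proof.
have -> : iota 0 n =
    iota 0 (k - g) ++ (k - g) :: iota (k - g).+1 (g - 1) ++ iota k (n - k).
  have -> : iota 0 n = iota 0 ((k - g) + (1 + ((g - 1) + (n - k)))).
    by congr iota; lia.
  rewrite !iotaD /= add0n addn1; congr (_ ++ _ :: _ ++ iota _ _); lia.
have WE s : s < n -> (cadd i s \in W) = (s < k) && (s + g != k).
  by move=> lt_sn; rewrite W_def inE cpos_cadd_small.
rewrite filter_cat /= filter_cat.
have filt b m r : (forall s, m <= s < m + r -> (cadd i s \in W) = b) ->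
    [seq s <- iota m r | cadd i s \in W] = if b then iota m r else [::].
  move=> h; rewrite (eq_in_filter (a2 := fun=> b)); last first.
    by move=> s; rewrite mem_iota => /h.
  by case: b {h}; rewrite ?filter_predT ?filter_pred0.
rewrite (filt true 0) => [|s hs]; last by rewrite WE; lia.
rewrite (filt true (k - g).+1) => [|s hs]; last by rewrite WE; lia.
rewrite (filt false) => [|s hs]; last by rewrite WE; lia.
have -> : cadd i (k - g) \in W = false by rewrite WE; lia.
by rewrite cats0.
Qed.

Lemma card_skip : #|W| = k.-1.
Proof.
rewrite -(size_csort i) csortE size_map offsets_skip size_cat !size_iota; lia.
Qed.

Lemma gale_skip B : #|B| = k.-1 ->
  gale i W B = ~~ ([set x | cpos i x + g <= k] \subset B).
Proof.
move=> cardB; rewrite gale_offsets offsets_skip.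
set t := filter _ (iota 0 n).
have size_t : size t = k.-1 by rewrite -cardB -(size_csort i) csortE size_map.
(* This is the pattern of [all2_leq_skip] with [m = 0] and [c = k - g], for which
   [size t - c = g - 1]. *)
have -> : iota (k - g).+1 (g - 1) = iota (0 + (k - g)).+1 (size t - (k - g)).
  by rewrite size_t; congr iota; lia.
have t_sorted : sorted ltn t.
  by apply: sorted_filter; [apply: ltn_trans | apply: iota_ltn_sorted].
rewrite all2_leq_skip // ?size_t; [|by apply/allP | by lia].
congr (~~ _); apply/allP/subsetP => [sub x | sub s].
  rewrite inE => le_xk; have /sub : cpos i x \in iota 0 (k - g).+1.
    by rewrite mem_iota; lia.
  by rewrite /= mem_filter cposK => /andP[].
rewrite mem_iota /= mem_filter mem_iota => lt_s.
have lt_sn : s < n by lia.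
by rewrite sub ?inE ?cpos_cadd_small //; lia.
Qed.

End Gale.

(** * Distances to the nearest elements outside A, and the sets T_i *)

Section Gaps.
Variables (n : nat) (A : {set 'I_n}).
Implicit Types (i x p u v : 'I_n).

(* The least g >= 1 such that i - g is not in A (a junk value if A is the
   whole ground set). *)
Definition bgap i : nat :=
  (find (fun s => cadd i (n - s.+1) \notin A) (iota 0 n)).+1.

Lemma bgap_gt0 i : 0 < bgap i. Proof. by []. Qed.

Lemma bgapP i v : v \notin A -> exists u,
  [/\ u \notin A, bgap i <= n, i = cadd u (bgap i)
    & forall r, 0 < r < bgap i -> cadd u r \in A].
Proof.
move=> vA; set P := fun s => cadd i (n - s.+1) \notin A.
have hasP : has P (iota 0 n).
  (* Index [s] stands for the element [i - (s + 1)], which is [v] when [s + 1 = n - cpos i v]. *)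
  apply/hasP; exists (n.-1 - cpos i v).
    by rewrite mem_iota; have := cpos_lt i v; lia.
  rewrite /P; have -> : n - (n.-1 - cpos i v).+1 = cpos i v.
    by have := cpos_lt i v; lia.
  by rewrite cposK.
have lt_f : find P (iota 0 n) < n by move: hasP; rewrite has_find size_iota.
have gE : bgap i = (find P (iota 0 n)).+1 by [].
exists (cadd i (n - bgap i)); split => //.
- by have := nth_find 0 hasP; rewrite nth_iota.
- by rewrite caddD subnK ?cadd_size.
move=> r /andP[r_gt0 lt_r]; rewrite caddD; apply: contraT => rA.
have lt_s : bgap i - r.+1 < find P (iota 0 n) by lia.
have := before_find 0 lt_s; rewrite nth_iota ?(ltn_trans lt_s) // add0n /P.
suff -> : n - (bgap i - r.+1).+1 = n - bgap i + r by rewrite rA.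
by lia.
Qed.

Lemma bgap_eq u s : u \notin A -> 0 < s <= n ->
  (forall r, 0 < r < s -> cadd u r \in A) -> bgap (cadd u s) = s.
Proof.
move=> uA /andP[s_gt0 le_sn] minA; set i := cadd u s.
have [u' [u'A le_gn iE minA']] := bgapP i uA.
have := bgap_gt0 i; move: (bgap i) => g in le_gn iE minA' * => g_gt0.
have [lt_gs|lt_sg|//] := ltngtP g s.
  case/negP: u'A; rewrite (cadd_cancel (ltnW lt_gs) iE) minA //; lia.
case/negP: uA; rewrite (cadd_cancel (ltnW lt_sg) (esym iE)) minA' //; lia.
Qed.

Lemma bgap_le u s : u \notin A -> 0 < s <= n -> bgap (cadd u s) <= s.
Proof.
move=> uA /andP[s_gt0 le_sn].
have [u' [u'A le_gn iE minA']] := bgapP (cadd u s) uA.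
rewrite leqNgt; apply/negP => lt_sg.
case/negP: uA; rewrite (cadd_cancel (ltnW lt_sg) (esym iE)) minA' //; lia.
Qed.

Lemma fgapP u v : v \notin A -> exists d,
  [/\ 0 < d <= n, cadd u d \notin A & forall r, 0 < r < d -> cadd u r \in A].
Proof.
move=> vA; have exd : exists d, (0 < d) && (cadd u d \notin A).
  (* [cpos u u = 0] is not a positive step, so a full turn is used when [u = v]. *)
  have [->|neq_uv] := eqVneq u v.
    by exists n; rewrite cadd_size vA (leq_trans _ (ltn_ord u)).
  exists (cpos u v); rewrite cposK vA andbT lt0n.
  by apply: contra neq_uv => /eqP e; rewrite -(cposK u v) e cadd0.
exists (ex_minn exd); case: ex_minnP => d /andP[d_gt0 dA] mind.
split => //; last first.
  move=> r /andP[r_gt0 lt_rd]; apply: contraT => rA.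
  by have := mind r; rewrite r_gt0 rA => /(_ isT); lia.
rewrite d_gt0 leqNgt; apply/negP => lt_nd.
have := mind (d - n).
suff -> : cadd u (d - n) = cadd u d.
  by rewrite dA andbT subn_gt0 lt_nd => /(_ isT); have := ltn_ord u; lia.
by rewrite -{2}(subnK (ltnW lt_nd)) -caddD cadd_size.
Qed.

(** The steps from [i] to the next element outside [A] stay in one run of [A], so the gap grows by
    their number. *)
Lemma bgap_next i v : v \notin A -> i \in A -> exists2 h, 0 < h &
  cadd i h \notin A /\ bgap (cadd i h) = bgap i + h.
Proof.
move=> vA iA; have [u [uA le_gn iE minu]] := bgapP i vA.
have [h [/andP[h_gt0 _] hA minh]] := fgapP i vA.
have uE : cadd i (n - bgap i) = u by rewrite {1}iE caddD subnKC ?cadd_size.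
have lt_gn : bgap i < n.
  rewrite ltn_neqAle le_gn andbT; apply/negP => /eqP gn.
  by move: uA; rewrite -uE gn subnn cadd0 iA.
(* [u] is outside [A], at [n - bgap i] steps after [i], so the first such element comes no later;
   this keeps the new gap at most [n]. *)
have le_hg : h <= n - bgap i.
  rewrite leqNgt; apply/negP => lt_h.
  by move: uA; rewrite -uE minh // subn_gt0 lt_gn.
exists h; rewrite // {2}iE caddD; split=> //.
apply: bgap_eq => //; first by lia.
move=> r /andP[r_gt0 lt_r]; case: (ltngtP r (bgap i)) => [lt_rg|lt_gr|->].
- by apply: minu; rewrite r_gt0.
- have -> : r = bgap i + (r - bgap i) by lia.
  by rewrite -caddD -iE minh //; lia.
- by rewrite -iE.
Qed.

Lemma shift_frozen k p :
  cadd p (n - k) \in A -> shift_perm A (uniform_perm n k) p = cadd p (n - k).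
Proof.
move=> pA; rewrite shift_permE next_nth ifN ?permE //.
by rewrite mem_enum inE permE pA.
Qed.

(** The uniform permutation sends position [p + s] to [u + s], so the next unfrozen position is as
    far from [p] as the next element outside [A] is from [u]. *)
Lemma shift_unfrozen k p d (u := cadd p (n - k)) :
  u \notin A -> 0 < d <= n -> cadd u d \notin A ->
  (forall r, 0 < r < d -> cadd u r \in A) ->
  shift_perm A (uniform_perm n k) p = cadd u d.
Proof.
move=> uA d_bnd dA minA; rewrite shift_permE /unfrozen.
have uE s : uniform_perm n k (cadd p s) = cadd u s.
  by rewrite permE !caddD addnC.
rewrite (next_enum (d := d)) ?inE ?uE //; first by rewrite permE.
by move=> s /minA sA; rewrite inE uE negbK.
Qed.

(* The cyclic interval T_i = [i, i + k - g(i)], or the empty set if g(i) > k. *)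
Definition obstr k i := [set x | cpos i x + bgap i <= k].

Lemma card_obstr k i : bgap i <= k <= n -> #|obstr k i| = (k - bgap i).+1.
Proof.
move=> /andP[le_gk le_kn].
have -> : obstr k i = [set x | cpos i x < (k - bgap i).+1].
  by apply/setP => x; rewrite !inE; lia.
by rewrite card_arc; have := bgap_gt0 i; lia.
Qed.

(** Moving the start forward by [h] raises the gap by [h], so the right end i + k - g(i) stays in
    place. *)
Lemma obstr_reduce k i v : v \notin A ->
  exists2 u, u \notin A & obstr k u \subset obstr k i.
Proof.
move=> vA; case: (boolP (i \in A)) => [iA|iA]; last by exists i.
have [h h_gt0 [hA gE]] := bgap_next vA iA.
exists (cadd i h) => //; apply/subsetP => x; rewrite !inE gE => le_k.
rewrite -(cposK (cadd i h) x) caddD cpos_cadd.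
by have := leq_mod (h + cpos (cadd i h) x) n; lia.
Qed.

(** If [i] lies [t + 1] steps after [j], then g(i) is at most [t + 1] because [j] is outside [A], so
    T_i runs past the right end of T_j. *)
Lemma obstr_antichain k i j : bgap i <= k <= n -> bgap j <= k ->
  i \notin A -> j \notin A -> 1 < bgap j -> obstr k i \subset obstr k j -> i = j.
Proof.
move=> /andP[le_gik le_kn] le_gjk iA jA gj sub.
have: i \in obstr k j by apply: (subsetP sub); rewrite inE cpos_ii.
rewrite inE; have := cposK j i; have := cpos_lt j i.
case: (cpos j i) => [|t] lt_tn iE le_t; first by rewrite -iE cadd0.
have le_gt : bgap i <= t.+1 by rewrite -iE bgap_le //; lia.
pose s := (k - bgap j).+1.
have lt_sn : s < n by lia.
have : cadd j s \in obstr k i.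
  rewrite inE; have -> : s = t.+1 + (s - t.+1) by lia.
  by rewrite -caddD iE cpos_cadd_small; lia.
by move/(subsetP sub); rewrite inE cpos_cadd_small //; lia.
Qed.

End Gaps.

(** * Weak excedances and bases of the shifted permutation *)

Section Bases.
Variables (n k : nat) (A : {set 'I_n}) (v : 'I_n).
Hypotheses (le_kn : k <= n) (vA : v \notin A).
Hypothesis le_gap : forall i, bgap A i <= k.
Implicit Types (i x p u : 'I_n) (B C : {set 'I_n}).
Let sigma := cyclic_shift A (uniform_decperm n k).

(** Position [p] starts with the value [u = p - k] and either keeps it or receives [u + d], the next
    element outside [A]. At an offset below [k], it stops being an excedance exactly when the new
    value reaches or passes [i], that is, when [u] is i - g(i). *)
Lemma weak_exc_shift i :
  weak_exc sigma i = [set x | (cpos i x < k) && (cpos i x + bgap A i != k)].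
Proof.
apply/setP => p; rewrite !inE /clt /=.
have := cposK i p; have := cpos_lt i p; move: (cpos i p) => s lt_sn pE.
pose u := cadd p (n - k).
have uE r : cadd u r = cadd i (s + (n - k + r)) by rewrite /u -pE !caddD addnA.
have uK : cadd u k = p.
  by rewrite uE subnK // -caddD pE cadd_size.
have [uA | uA] := boolP (u \in A).
  rewrite shift_frozen // -/u.
  have -> : cpos i u = (s + (n - k)) %% n.
    by rewrite -(cadd0 u) uE cpos_cadd addn0.
  (* Equality would make [u] the element i - g(i), which is outside [A]. *)
  have -> : s + bgap A i != k.
    apply/eqP => e; have [w [wA _ iE _]] := bgapP i vA.
    case/negP: wA; suff <- : u = w by [].
    by apply: (@cadd_inj _ k); rewrite uK -e addnC -caddD -iE.
  rewrite andbT; case: eqP => [kn | /eqP neq_kn].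
    have up : u = p by rewrite /u kn subnn cadd0.
    by rewrite inE -up uA /= kn lt_sn.
  rewrite inE /=; case: (ltnP s k) => [lt_sk | le_ks].
    by rewrite modn_small; lia.
  have -> : s + (n - k) = s - k + n by lia.
  by rewrite modnDr modn_small; lia.
have -> : (p \in if k == n then [set: 'I_n] else set0) && (p \in A) = false.
  case: eqP => [kn|_]; rewrite inE //.
  by apply: negbTE; rewrite -uK kn cadd_size.
have [d [d_bnd dA mind]] := fgapP u vA.
rewrite (shift_unfrozen uA d_bnd dA mind) -/u uE cpos_cadd /=.
have le_dk : d <= k by rewrite -(bgap_eq uA d_bnd mind).
(* If [s + d >= k], the value wraps to offset [s + d - k <= s]; otherwise it advances without
   wrapping. *)
case: (leqP k (s + d)) => [le_k | lt_k].
  have -> : s + (n - k + d) = s + d - k + n by lia.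
  rewrite modnDr modn_small; last by lia.
  case: (ltnP s k) => [lt_sk|]; last by lia.
  have iE : cadd u (k - s) = i.
    by apply: (@cadd_inj _ s); rewrite /= caddD subnK ?uK //; lia.
  have : bgap A (cadd u (k - s)) = k - s.
    apply: bgap_eq => // [|r ?]; first by lia.
    by apply: mind; lia.
  rewrite iE; lia.
rewrite modn_small; last by lia.
(* The element [u + d] outside [A] lies [k - s - d] steps before [i], so the gap at [i] is less than
   [k - s]. *)
have : bgap A (cadd (cadd u d) (k - s - d)) <= k - s - d.
  by apply: bgap_le; lia.
have -> : cadd (cadd u d) (k - s - d) = i.
  apply: (@cadd_inj _ s); rewrite /= !(caddD u) pE -[RHS]uK; congr (cadd _ _); lia.
by lia.
Qed.

(** All W_i have [k - 1] elements, so [gale_skip] applies at every [i]; the conditions at [i] in [A]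
    follow from the others by [obstr_reduce]. *)
Lemma mem_positroid B : (B \in positroid sigma) =
  (#|B| == k.-1) && [forall i in ~: A, ~~ (obstr A k i \subset B)].
Proof.
have cardW i : #|weak_exc sigma i| = k.-1.
  exact: card_skip (bgap_gt0 A i) (le_gap i) le_kn (weak_exc_shift i).
rewrite inE; apply/forallP/andP => [gB | [/eqP cardB noB] i].
  have cardB : #|B| = k.-1 by have /andP[/eqP -> _] := gB v.
  split; first exact/eqP.
  apply/forall_inP => i _; have /andP[_] := gB i.
  by rewrite (gale_skip (bgap_gt0 A i) (le_gap i) le_kn (weak_exc_shift i)).
rewrite cardW cardB eqxx.
rewrite (gale_skip (bgap_gt0 A i) (le_gap i) le_kn (weak_exc_shift i)) //.
have [u uA sub] := obstr_reduce k i vA.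
have := forall_inP noB u; rewrite inE => /(_ uA).
by apply: contra; apply: subset_trans.
Qed.

(** * Independent sets and circuits *)

Hypothesis gap_eqn : forall i j, k = n -> i \notin A -> j \notin A ->
  1 < bgap A i -> 1 < bgap A j -> i = j.

Definition obstr_free C := [forall i in ~: A, ~~ (obstr A k i \subset C)].

Lemma obstr_freeP C :
  reflect (forall i, i \notin A -> ~~ (obstr A k i \subset C)) (obstr_free C).
Proof.
apply: (iffP forall_inP) => h i.
  by move=> iA; apply: h; rewrite inE.
by rewrite inE => /h.
Qed.

Lemma obstr_free_extend C : obstr_free C -> #|C| < k.-1 ->
  exists2 x, x \notin C & obstr_free (x |: C).
Proof.
move=> /obstr_freeP freeC lt_C.
apply/exists_inP; apply: contraT; rewrite negb_exists_in => /forall_inP stuck.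
have blocked x : x \notin C -> exists i,
    [/\ i \notin A, x \in obstr A k i
      & forall y, y \in obstr A k i -> y \notin C -> y = x].
  move=> xC; have := stuck x xC; rewrite negb_forall_in => /exists_inP[i].
  rewrite inE negbK => iA sub; exists i.
  have only y : y \in obstr A k i -> y \notin C -> y = x.
    by move=> /(subsetP sub) /setU1P[] // -> .
  split => //; apply: contraT => xi; case/negP: (freeC i iA).
  apply/subsetP => y yi; apply: contraT => yC.
  by rewrite -(only y yi yC) yi in xi.
have pick_out (D : {set 'I_n}) : #|D| < n -> exists x, x \notin D.
  move=> lt_D; apply/existsP; rewrite -negb_forall; apply/negP => /forallP allD.
  by move: lt_D; rewrite (eq_card (B := 'I_n)) ?card_ord ?ltnn.
have [x xC] : exists x, x \notin C by apply: pick_out; lia.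
have [i [iA xi only_x]] := blocked x xC.
have [y0 y0_out] : exists y, y \notin x |: C.
  by apply: pick_out; rewrite cardsU1; lia.
(* Counted from [i], [y] is the first element outside [C] other than [x]. *)
case: (@arg_minnP _ y0 [pred y | y \notin x |: C] (cpos i) y0_out) => y /=.
rewrite in_setU1 negb_or => /andP[neq_yx yC] min_y.
have [j [jA yj only_y]] := blocked y yC.
have yNi : y \notin obstr A k i by apply/negP => /only_x/(_ yC) /eqP; apply/negP.
have xNj : x \notin obstr A k j.
  by apply/negP => /only_y/(_ xC) /esym/eqP; apply/negP.
have neq_ij : i != j by apply: contraNneq yNi => ->.
(* For [k = n], a T_z that misses an element has gap above 1. Here T_i misses [y] and T_j misses
   [x], so [gap_eqn] forces [i = j]. *)
have [kn|neq_kn] := eqVneq k n.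
  have gap_gt1 z w : w \notin obstr A k z -> 1 < bgap A z.
    by rewrite inE; have := cpos_lt z w; have := bgap_gt0 A z; lia.
  by case/eqP: neq_ij; apply: gap_eqn => //; apply: gap_gt1; eassumption.
move: xi yNi yj xNj; rewrite !inE -!ltnNge => xi yNi yj xNj.
have shift_pos z : cpos j z = (n - cpos i j + cpos i z) %% n.
  rewrite -(cpos_cadd j) -{3}(cposK i j) caddD.
  have -> : cpos i j + (n - cpos i j + cpos i z) = cpos i z + n.
    by have := cpos_lt i j; lia.
  by rewrite -caddD cadd_size cposK.
have [lt_x lt_y lt_j] : [/\ cpos i x < n, cpos i y < n & cpos i j < n].
  by split; apply: cpos_lt.
(* Counted from [i], [x] precedes [y]; if [j] came after [y], T_j would wrap past [i] and contain
   [x] before reaching [y]. *)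
have le_jy : cpos i j <= cpos i y.
  rewrite leqNgt; apply/negP => lt_yj.
  move: yj xNj; rewrite !shift_pos !modn_small; lia.
have j_gt0 : 0 < cpos i j.
  by rewrite lt0n; apply: contra neq_ij => /eqP e; rewrite -(cposK i j) e cadd0.
have gap_j : bgap A j <= cpos i j by rewrite -{1}(cposK i j) bgap_le // j_gt0 ltnW.
(* Offsets before [y] are covered by the choice of [y]. As the gap at [j] is at most [cpos i j], T_j
   reaches offset [k] and covers the rest. These [k + 1] elements outnumber [#|C| + 2]. *)
have : [set z | cpos i z < k.+1] \subset x |: (y |: C).
  apply/subsetP => z; rewrite inE => le_z; apply: contraT.
  rewrite !in_setU1 !negb_or => /and3P[neq_zx neq_zy zC].
  have le_yz : cpos i y <= cpos i z by apply: min_y; rewrite in_setU1 negb_or neq_zx.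
  case/eqP: neq_zy; apply: only_y => //; rewrite inE shift_pos.
  have -> : n - cpos i j + cpos i z = cpos i z - cpos i j + n by lia.
  by rewrite modnDr modn_small; have := cpos_lt i z; lia.
move/subset_leq_card; rewrite card_arc !cardsU1.
rewrite leqNgt; case: (x \notin _); case: (y \notin _); set c := #|C| in lt_C *; lia.
Qed.

(** By [obstr_free_extend] a free set grows to size [k - 1], where being free means being a
    basis. *)
Lemma independentE C :
  independent (positroid sigma) C = (#|C| < k) && obstr_free C.
Proof.
apply/exists_inP/andP => [[B] | [lt_C freeC]].
  rewrite mem_positroid => /andP[/eqP cardB /forall_inP freeB] sub.
  split.
    rewrite (leq_ltn_trans (subset_leq_card sub)) // cardB.
    by have := le_gap v; have := bgap_gt0 A v; lia.
  apply/obstr_freeP => i iA; have := freeB i; rewrite inE => /(_ iA).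
  by apply: contra => /subset_trans; apply.
move: {2}(k - #|C|) (leqnn (k - #|C|)) => m.
elim: m C lt_C freeC => [|m IH] C lt_C freeC le_m; first by lia.
have [lt_C1 | ge_C] := ltnP #|C| k.-1; last first.
  exists C => //; rewrite mem_positroid -[X in _ && X]/(obstr_free C) freeC andbT.
  by apply/eqP; lia.
have [x xC freeCx] := obstr_free_extend freeC lt_C1.
have [||B B_basis sub] := IH _ _ freeCx; try by rewrite cardsU1 xC; lia.
by exists B => //; apply: subset_trans sub; apply: subsetUr.
Qed.

Lemma circuits_shift : circuits (positroid sigma) =
  [set obstr A k i | i in [set i | (i \notin A) && (1 < bgap A i)]]
  :|: [set C : {set 'I_n} | (#|C| == k) &&
    [forall i in [set i | (i \notin A) && (1 < bgap A i)],
       ~~ (obstr A k i \subset C)]].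
Proof.
have k_gt0 : 0 < k by have := le_gap v; have := bgap_gt0 A v; lia.
have gap_bnd i : bgap A i <= k <= n by rewrite le_gap.
have dep_obstr i : i \notin A -> ~~ independent (positroid sigma) (obstr A k i).
  move=> iA; rewrite independentE negb_and; apply/orP; right.
  by apply/negP => /obstr_freeP/(_ i iA); rewrite subxx.
have dep_big C : k <= #|C| -> ~~ independent (positroid sigma) C.
  by move=> le_k; rewrite independentE ltnNge le_k.
have dep_small C : #|C| < k -> ~~ independent (positroid sigma) C ->
    exists i, [/\ i \notin A, 1 < bgap A i & obstr A k i \subset C].
  move=> lt_C; rewrite independentE lt_C negb_forall_in => /exists_inP[i].
  rewrite inE negbK => iA sub; exists i; split => //.
  by have := leq_ltn_trans (subset_leq_card sub) lt_C; rewrite card_obstr //; lia.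
apply/setP => C; rewrite !inE; apply/minsetP/orP.
  move=> [depC minC].
  have [freeC | ] := boolP (obstr_free C); last first.
    rewrite negb_forall_in => /exists_inP[i]; rewrite inE => iA.
    rewrite negbK => sub; have eC := minC _ (dep_obstr i iA) sub.
    have [lt_g|le_g] := ltnP 1 (bgap A i).
      by left; apply/imsetP; exists i; rewrite ?inE ?iA.
    right; rewrite -eC card_obstr //.
    (* With gap 1, T_i has [k] elements; a short T_j inside it would equal it by minimality, yet has
       fewer elements. *)
    have -> : bgap A i = 1 by have := bgap_gt0 A i; lia.
    rewrite subn1 prednK // eqxx /=; apply/forall_inP => j.
    rewrite inE => /andP[jA gj]; apply/negP; rewrite eC => subj.
    have := card_obstr (gap_bnd j); rewrite (minC _ (dep_obstr j jA) subj) -eC.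
    by rewrite card_obstr //; have := le_gap j; lia.
  have le_k : k <= #|C|.
    by rewrite leqNgt; apply/negP => lt_C; rewrite independentE lt_C freeC in depC.
  (* [C] is dependent by size alone, and any of its [k]-subsets already is, so minimality gives
     [#|C| = k]. *)
  right; have [D [subD cardD]] : exists D : {set 'I_n}, D \subset C /\ #|D| = k.
    have: 0 < #|[set D : {set 'I_n} | D \subset C & #|D| == k]|.
      by rewrite cards_draws bin_gt0.
    by case/card_gt0P => D; rewrite inE => /andP[? /eqP]; exists D.
  have <- : D = C by apply: minC => //; apply: dep_big; rewrite cardD.
  rewrite cardD eqxx; apply/forall_inP => i; rewrite inE => /andP[iA _].
  apply/negP => /subset_trans/(_ subD); apply/negP.
  by move/obstr_freeP: freeC; apply.
case=> [/imsetP[j] | /andP[/eqP cardC /forall_inP freeC]].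
  rewrite inE => /andP[jA gj] ->{C}; split=> [|D depD subD]; first exact: dep_obstr.
  have lt_D : #|D| < k.
    apply: leq_ltn_trans (subset_leq_card subD) _.
    by rewrite card_obstr //; have := le_gap j; lia.
  have [i [iA gi subi]] := dep_small D lt_D depD.
  have eij := obstr_antichain (gap_bnd i) (le_gap j) iA jA gj (subset_trans subi subD).
  by apply/eqP; rewrite eqEsubset subD -eij.
split=> [|D depD subD]; first by rewrite dep_big ?cardC.
apply/eqP; rewrite eqEcard subD cardC leqNgt; apply/negP => lt_D.
have [i [iA gi subi]] := dep_small D lt_D depD.
have := freeC i; rewrite inE iA gi => /(_ isT)/negP; apply.
exact: subset_trans subi subD.
Qed.

End Bases.

(** * Cyclic components and their neighbours outside A *)

Section Components.
Variables (n : nat) (A : {set 'I_n}).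
Implicit Types (a b x : 'I_n).

Lemma cyclic_interval_cint a b : cyclic_interval (cint a b).
Proof. by apply/existsP; exists a; apply/existsP; exists b. Qed.

(** If [b + 1] or [u = a - 1] were in [A], adjoining it would give a larger cyclic interval inside
    [A]; both are new elements since [l < n]. *)
Lemma component_bounds a b (l := #|cint a b|) :
  cint a b \in cyclic_components A -> l < n ->
  [/\ 0 < l, b \in A, cadd b 1 \notin A, bgap A (cadd b 1) = l.+1
    & exists2 u, u \notin A & b = cadd u l].
Proof.
rewrite inE => /maxsetP[/andP[_ /subsetP subA] maxC] lt_ln.
have memC x : (x \in cint a b) = (cpos a x <= cpos a b) by rewrite cintE inE.
have lE : l = (cpos a b).+1.
  rewrite /l; have -> : cint a b = [set x | cpos a x < (cpos a b).+1].
    by apply/setP => x; rewrite memC inE.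
  by rewrite card_arc; have := cpos_lt a b; lia.
set t := cpos a b in memC lE.
have bE : b = cadd a t by rewrite cposK.
have [u uE] : exists u, a = cadd u 1.
  by exists (cadd a n.-1); rewrite caddD addn1 prednK ?cadd_size //; lia.
have arcA s : s <= t -> cadd a s \in A.
  by move=> le_st; rewrite subA // memC cpos_cadd_small; lia.
have nextA : cadd b 1 \notin A.
  apply/negP => b1A; have cb1 : cpos a (cadd b 1) = t.+1.
    by rewrite bE caddD addn1 cpos_cadd_small //; lia.
  have eT : cint a (cadd b 1) = cint a b.
    apply: maxC; last by apply/subsetP => x; rewrite memC cintE inE cb1; lia.
    rewrite cyclic_interval_cint; apply/subsetP => x; rewrite cintE inE cb1.
    rewrite leq_eqVlt => /orP[/eqP cx | lt_x]; last by rewrite -(cposK a x) arcA.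
    by rewrite -(cposK a x) cx -cb1 cposK.
  have : cadd b 1 \in cint a b by rewrite -eT cintE inE.
  by rewrite memC cb1 ltnn.
have posu x : x \in cint a b -> cpos u x = (cpos a x).+1.
  rewrite memC => le_x; rewrite -{1}(cposK a x) uE caddD add1n -uE.
  by rewrite cpos_cadd_small //; lia.
have uA : u \notin A.
  apply/negP => uA; have bC : b \in cint a b by rewrite memC.
  have eT : cint u b = cint a b.
    apply: maxC; last first.
      by apply/subsetP => x xC; rewrite cintE inE !posu // ltnS -memC.
    rewrite cyclic_interval_cint; apply/subsetP => x; rewrite cintE inE (posu b bC) -/t.
    case: (cpos u x) (cposK u x) => [|s] <-; first by rewrite cadd0.
    by rewrite ltnS => le_st; rewrite -add1n -caddD -uE arcA.
  have /posu : u \in cint a b by rewrite -eT cintE inE cpos_ii.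
  by rewrite cpos_ii.
have bEu : b = cadd u l by rewrite bE uE caddD lE.
split; first by rewrite lE.
- by rewrite bE arcA.
- by [].
- rewrite bEu caddD addn1 in nextA *; apply: bgap_eq => // -[//|s] /= lt_s.
  by rewrite -add1n -caddD -uE arcA //; lia.
- by exists u.
Qed.

Lemma component_exists x : x \in A ->
  exists a b, cint a b \in cyclic_components A /\ x \in cint a b.
Proof.
move=> xA.
have [|M maxM subM] := @maxset_exists _
    (fun T : {set 'I_n} => cyclic_interval T && (T \subset A)) (cint x x).
  rewrite cyclic_interval_cint; apply/subsetP => y.
  by rewrite cintE inE cpos_ii leqn0 => /eqP cy; rewrite -(cposK x y) cy cadd0.
have /andP[/existsP[a /existsP[b /eqP ME]] _] := maxsetp maxM.
exists a, b; rewrite inE -ME; split=> //.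
by apply: (subsetP subM); rewrite cintE inE.
Qed.

End Components.

(** If [l j >= k], truncated subtraction would turn the listed interval into the whole ground set;
    [hlk] excludes this. As for [hkn]: with k = n = 4 and A = {1, 3}, the only circuit is {2, 4},
    whereas the formula lists {2, 3, 4}. *)
Theorem theorem29 (n k m : nat) (A : {set 'I_n}) (a e : 'I_m -> 'I_n)
    (l : 'I_m -> nat)
    (hk : 1 <= k <= n)
    (hinj : injective (fun j : 'I_m => cint (a j) (e j)))
    (hA : cyclic_components A = [set cint (a j) (e j) | j : 'I_m])
    (hl : forall j : 'I_m, l j = #|cint (a j) (e j)|)
    (hlk : forall j : 'I_m, l j < k)
    (hkn : k = n -> m <= 1) :
  let sigma := cyclic_shift A (uniform_decperm n k) in
  circuits (positroid sigma) =
    [set cint (cadd (e j) 1) (cadd (e j) (k - l j)) | j : 'I_m]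
    :|: [set C : {set 'I_n} | (#|C| == k) &&
          [forall j : 'I_m,
             ~~ (cint (cadd (e j) 1) (cadd (e j) (k - l j)) \subset C)]]
  /\
  [set C in circuits (positroid sigma) | #|C| < k] =
    [set cint (cadd (e j) 1) ((dp_perm sigma)^-1%g (cadd (e j) 1)) | j : 'I_m].
Proof.
have /andP[k_gt0 le_kn] := hk.
have bounds j : [/\ 0 < l j, e j \in A, cadd (e j) 1 \notin A,
    bgap A (cadd (e j) 1) = (l j).+1
    & exists2 u, u \notin A & e j = cadd u (l j)].
  rewrite !hl; apply: component_bounds; first by rewrite hA; apply/imsetP; exists j.
  by rewrite -hl (leq_trans (hlk j)).
(* If [x] is in [A], its component has fewer than [n] elements and is followed by an element outside
   [A]. *)
have [v vA] : exists v, v \notin A.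
  pose x : 'I_n := Ordinal (leq_trans k_gt0 le_kn).
  have [/component_exists[b [c []]]|] := boolP (x \in A); last by exists x.
  by rewrite hA => /imsetP[j _ _] _; exists (cadd (e j) 1); case: (bounds j).
have ends i : i \notin A -> 1 < bgap A i -> exists j, i = cadd (e j) 1.
  move=> iA gi; have [u [uA le_gn iE minu]] := bgapP i vA.
  pose p := cadd u (bgap A i).-1.
  have pA : p \in A by apply: minu; lia.
  have iEp : i = cadd p 1 by rewrite caddD addn1 prednK ?bgap_gt0.
  have [b [c []]] := component_exists pA.
  rewrite hA => /imsetP[j _ ->] pj; exists j.
  suff -> : e j = p by [].
  have subA : cint (a j) (e j) \subset A.
    have : cint (a j) (e j) \in cyclic_components A by rewrite hA; apply/imsetP; exists j.
    by rewrite inE => /maxsetp/andP[].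
  (* If [p] were not the last element of its component, [i = p + 1] would also lie in it. *)
  move: pj; rewrite cintE inE leq_eqVlt => /orP[/eqP/cpos_inj -> // | lt_p].
  case/negP: iA; apply: (subsetP subA); rewrite cintE inE.
  rewrite iEp -(cposK (a j) p) caddD addn1 cpos_cadd_small //.
  by apply: leq_ltn_trans lt_p (cpos_lt _ _).
have le_gap_out i : i \notin A -> bgap A i <= k.
  move=> iA; have [lt_g|le_g] := ltnP 1 (bgap A i); last exact: leq_trans k_gt0.
  by have [j ->] := ends i iA lt_g; have [_ _ _ -> _] := bounds j.
have le_gap i : bgap A i <= k.
  have [iA|/le_gap_out //] := boolP (i \in A).
  have [h h_gt0 [/le_gap_out hA' gE]] := bgap_next vA iA.
  by apply: leq_trans hA'; rewrite gE leq_addr.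
have gap_eqn i j : k = n -> i \notin A -> j \notin A ->
    1 < bgap A i -> 1 < bgap A j -> i = j.
  move=> /hkn le_m1 iA jA /(ends i iA)[p ->] /(ends j jA)[q ->].
  suff -> : p = q by [].
  by apply/val_inj; have := ltn_ord p; have := ltn_ord q => /=; lia.
have obstrE j :
    cint (cadd (e j) 1) (cadd (e j) (k - l j)) = obstr A k (cadd (e j) 1).
  have [l_gt0 _ _ gE _] := bounds j; have lt_lk := hlk j.
  have -> : k - l j = 1 + (k - (l j).+1) by lia.
  by apply/setP => x; rewrite -caddD cintE !inE gE cpos_cadd_small; lia.
have circE := circuits_shift le_kn vA le_gap gap_eqn.
move=> sigma; rewrite -/sigma in circE.
have small_obstr j : #|obstr A k (cadd (e j) 1)| < k.
  have [l_gt0 _ _ gE _] := bounds j; have lt_lk := hlk j.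
  by rewrite card_obstr gE; lia.
have obstr_imset :
    [set obstr A k i | i in [set i | (i \notin A) && (1 < bgap A i)]] =
    [set cint (cadd (e j) 1) (cadd (e j) (k - l j)) | j : 'I_m].
  apply/setP => C; apply/imsetP/imsetP => [[i] | [j _ ->]].
    rewrite inE => /andP[iA gi] ->; have [j ->] := ends i iA gi.
    by exists j; rewrite ?obstrE.
  have [l_gt0 _ jA gE _] := bounds j.
  by exists (cadd (e j) 1); rewrite ?obstrE // inE jA gE ltnS.
have circE1 : circuits (positroid sigma) =
    [set cint (cadd (e j) 1) (cadd (e j) (k - l j)) | j : 'I_m]
    :|: [set C : {set 'I_n} | (#|C| == k) &&
          [forall j : 'I_m,
             ~~ (cint (cadd (e j) 1) (cadd (e j) (k - l j)) \subset C)]].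
  rewrite circE obstr_imset; congr (_ :|: _); apply/setP => C; rewrite !inE.
  congr (_ && _); apply/forall_inP/forallP => [noC j | noC i].
    have [l_gt0 _ jA gE _] := bounds j.
    by rewrite obstrE; apply: noC; rewrite inE jA gE ltnS.
  by rewrite inE => /andP[iA /(ends i iA)[j ->]]; rewrite -obstrE.
split=> //; rewrite circE1.
(* Before the shift this position holds [u], the last element outside [A] before the component; the
   next one is [e j + 1], at [l j + 1] steps. *)
have invE j : ((dp_perm sigma)^-1)%g (cadd (e j) 1) = cadd (e j) (k - l j).
  have [l_gt0 eA jA gE [u uA eE]] := bounds j; have lt_lk := hlk j.
  have uK : cadd (cadd (e j) (k - l j)) (n - k) = u.
    rewrite eE !caddD; have -> : l j + (k - l j + (n - k)) = n by lia.
    exact: cadd_size.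
  apply: (canLR (permK _)); rewrite /=.
  have uE : cadd u (l j).+1 = cadd (e j) 1 by rewrite eE caddD addn1.
  have /= := @shift_unfrozen n A k (cadd (e j) (k - l j)) (l j).+1.
  rewrite uK uE => -> //; first by lia.
  move=> r /andP[r_gt0 lt_r]; rewrite -uE in gE.
  (* An element [u + r] outside [A] would make the gap at [e j + 1] smaller than [l j + 1]. *)
  apply: contraT => rA.
  have : bgap A (cadd (cadd u r) ((l j).+1 - r)) <= (l j).+1 - r.
    by apply: bgap_le => //; lia.
  by rewrite caddD subnKC ?gE; lia.
apply/setP => C; rewrite !inE; apply/andP/imsetP => [[+ lt_C] | [j _ ->]].
  case/orP => [/imsetP[j _ ->] | /andP[/eqP cardC _]].
    by exists j; rewrite // invE.
  by rewrite cardC ltnn in lt_C.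
rewrite invE obstrE small_obstr; split=> //; apply/orP; left.
by apply/imsetP; exists j; rewrite ?obstrE.
Qed.
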